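(* Let $\mathbb{S}$ be the double arrow space. If $K$ is any product of a nonempty family of nonmetrizable separable compact lines, then the Banach spaces $C(\mathbb{S})$ and $C(\mathbb{S}\times K)$ are not isomorphic.
   Context: A compact line is a linearly ordered set that is compact in its order topology. The double arrow space $\mathbb{S}$ is the lexicographic product $[0,1]\times_{lex}\{0,1\}$ with the order topology, with the two isolated endpoints $(0,0)$ and $(1,1)$ removed. $C(K)$ is the Banach space of real-valued continuous functions on a compact space $K$ with the supremum norm; isomorphic means linearly homeomorphic. *)

(* Defs.v *)
From HB Require Import structures.
From mathcomp Require Import all_boot all_order all_algebra ring lra.
From mathcomp Require Import all_classical all_reals all_analysis.

Set Implicit Arguments.
Unset Strict Implicit.
Unset Printing Implicit Defensive.

Import Order.TTheory GRing.Theory Num.Theory.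
Import numFieldNormedType.Exports.

Local Open Scope classical_set_scope.
Local Open Scope ring_scope.

Definition homeomorphic (T U : topologicalType) : Prop :=
  exists (f : T -> U) (g : U -> T),
    [/\ cancel f g, cancel g f, continuous f & continuous g].

Definition metrizable (R : realType) (T : topologicalType) : Prop :=
  exists M : metricType R, homeomorphic T M.

Definition separable (T : topologicalType) : Prop :=
  exists2 D : set T, countable D & dense D.

HB.mixin Record Topological_isCompact T & Topological T := {
  compactT : compact [set: T]
}.

#[short(type="compactSpaceType")]
HB.structure Definition CompactSpace :=
  { T of Topological T & Topological_isCompact T }.

(* [OrderTopological] says that the topology is the order topology of the total
   order *)
#[short(type="compactLineType")]
HB.structure Definition CompactLine d :=
  { T of OrderTopological d T & Topological_isCompact T }.

Section compact_products.

Lemma prod_compactT (S T : compactSpaceType) : compact [set: S * T].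
Proof. by rewrite -setXTT; exact/compact_setX/compactT/compactT. Qed.

HB.instance Definition _ (S T : compactSpaceType) :=
  Topological_isCompact.Build (S * T)%type (@prod_compactT S T).

Lemma prod_topology_compactT (I : Type) (T : I -> compactSpaceType) :
  compact [set: prod_topology T].
Proof.
have := @tychonoff {classic I} T (fun i => [set: T i])
  (fun i => @compactT (T i)).
by congr compact; apply/seteqP; split.
Qed.

HB.instance Definition _ (I : Type) (T : I -> compactSpaceType) :=
  Topological_isCompact.Build (prod_topology T) (@prod_topology_compactT I T).

End compact_products.

Section double_arrow.
Variable R : realType.

Definition unit_interval : Type := {x : R | 0 <= x <= 1}.

HB.instance Definition _ := SubChoice.on unit_interval.
HB.instance Definition _ :=
  [SubChoice_isSubOrder of unit_interval by <: with ring_display].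

Definition ui0 : unit_interval.
Proof. by exists 0; rewrite lexx ler01. Defined.

Definition ui1 : unit_interval.
Proof. by exists 1; rewrite lexx ler01. Defined.

(* [false < true] in [bool], so [false] and [true] play the roles of 0 and 1 *)
Definition split_interval : Type := order_topology (unit_interval *l bool)%type.

HB.instance Definition _ := Order.Total.on split_interval.
HB.instance Definition _ := OrderTopological.on split_interval.

Definition split_min : split_interval := (ui0, false).
Definition split_max : split_interval := (ui1, true).

(* a set used as a type carries the subspace topology *)
Definition double_arrow : Type :=
  [set p : split_interval | p <> split_min /\ p <> split_max].

HB.instance Definition _ := Topological.on double_arrow.

Lemma le_split (p q : split_interval) :
  (p <= q)%O = (val p.1 <= val q.1) && ((val q.1 <= val p.1) ==> (p.2 <= q.2)%O).
Proof. by []. Qed.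

Lemma lt_split (p q : split_interval) :
  (p < q)%O = (val p.1 <= val q.1) && ((val q.1 <= val p.1) ==> (p.2 < q.2)%O).
Proof.
rewrite ltNge le_split; case: p q => [[x xP] i] [[y yP] j] /=.
by case: i j => [] []; case: (ltgtP x y).
Qed.

Lemma split_complete (A : set split_interval) :
  exists s : split_interval, ubound A s /\ lbound (ubound A) s.
Proof.
pose B : set R := [set val p.1 | p in A].
have B_ub : has_ubound B.
  by exists 1 => _ [[[x xP] i] _ <-] /=; case/andP: xP.
have s_itv : 0 <= sup B <= 1.
  have [->|/set0P B0] := eqVneq B set0; first by rewrite sup0 lexx ler01.
  apply/andP; split; last first.
    by apply: ge_sup => // _ [[[x xP] i] _ <-] /=; case/andP: xP.
  have [x Bx] := B0; apply: (@le_trans _ _ x); last exact: ub_le_sup.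
  by case: Bx => -[[y yP] i] _ <- /=; case/andP: yP.
pose a : unit_interval := exist _ (sup B) s_itv.
have Ba p : A p -> val p.1 <= sup B.
  by move=> Ap; apply: ub_le_sup => //; exists p.
have [Aa|nAa] := pselect (A (a, true)).
  exists (a, true); split => [p Ap|u]; last exact.
  by rewrite le_split /= Ba //= lex1 implybT.
exists (a, false); split => [p Ap|u uA]; rewrite le_split /=.
  rewrite Ba //=; apply/implyP => ap.
  case: p Ap ap => [x [|]] //= Ax ax; exfalso; apply: nAa.
  suff <- : x = a by [].
  by apply/val_inj/eqP; rewrite eq_le ax andbT; exact: (Ba (x, true)).
rewrite le0x implybT andbT.
have [B0|/set0P B0] := eqVneq B set0.
  by rewrite B0 sup0; case: (u.1) => x /= /andP[].
apply: ge_sup => // _ [p Ap <-].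
by have := uA _ Ap; rewrite le_split => /andP[].
Qed.

Lemma split_compactT : compact [set: split_interval].
Proof.
rewrite compact_ultra => F UF _.
pose A : set split_interval := [set x | F `[x, +oo[%classic].
have [s [sA leAs]] := split_complete A; exists s; split => //.
have Fr (r : split_interval) : (s < r)%O -> F `]-oo, r[%classic.
  move=> sr; have [//|] := in_ultra_setVsetC `]-oo, r[%classic UF.
  rewrite setCitvl => Ar; have := sA r Ar.
  by rewrite leNgt sr.
have Fl (l : split_interval) : (l < s)%O -> F `]l, +oo[%classic.
  move=> ls; have [x [Ax lx]] : exists x, A x /\ (l < x)%O.
    apply: contrapT => nA; have : (s <= l)%O.
      apply: leAs => x Ax; rewrite leNgt; apply/negP => lx; apply: nA.
      by exists x.
    by rewrite leNgt ls.
  by apply: filterS Ax => y; rewrite /= !in_itv /= !andbT; exact: lt_le_trans.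
move=> U; rewrite itv_nbhsE => -[[[[]l|[]] [[]r|[]]] [//= _]];
  rewrite in_itv /= ?andbT => si /filterS; apply.
- by case/andP: si => /Fl ? /Fr ?; rewrite set_itv_splitI; exact: filterI.
- exact: Fl.
- exact: Fr.
- by rewrite set_itvE; exact: filterT.
Qed.

Lemma split_min_open : open [set split_min].
Proof.
pose r : split_interval := (ui0, true).
have -> : [set split_min] = `]-oo, r[%classic; last exact: lray_open.
apply/seteqP; split => [_ ->|[x i]]; rewrite /= in_itv /= lt_split /= ?lexx //.
case/andP=> x0 /implyP xi; have x00 : x = ui0.
  by apply/val_inj/eqP; rewrite eq_le x0; case: (x) => ? /= /andP[].
by rewrite x00 /= lexx in xi *; case: i xi => // /(_ isT).
Qed.

Lemma split_max_open : open [set split_max].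
Proof.
pose l : split_interval := (ui1, false).
have -> : [set split_max] = `]l, +oo[%classic; last exact: rray_open.
apply/seteqP; split => [_ ->|[x i]];
  rewrite /= in_itv /= andbT lt_split /= ?lexx //.
case/andP=> x1 /implyP xi; have x11 : x = ui1.
  by apply/val_inj/eqP; rewrite eq_le x1 andbT; case: (x) => ? /= /andP[].
by rewrite x11 /= lexx in xi *; case: i xi => // /(_ isT).
Qed.

Lemma double_arrow_compactT : compact [set: double_arrow].
Proof.
pose D : set split_interval := [set p | p <> split_min /\ p <> split_max].
have cD : compact D.
  apply: (subclosed_compact _ split_compactT) => //.
  rewrite (_ : D = ~` ([set split_min] `|` [set split_max])).
    by apply: open_closedC; apply: openU; [exact: split_min_open|exact: split_max_open].
  by rewrite setCU.
move=> F FF _.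
have FD : F [set x : double_arrow | D (set_val x)].
  by apply: (filterS _ (@filterT _ F _)) => x _; exact: set_valP.
have [p [Dp clp]] := cD _ (fmap_proper_filter _ FF) FD.
exists (exist _ p (mem_set Dp)); split => // P Q FP [_ [[W oW <-] /= Wp WQ]].
have FP' : F [set x : double_arrow | (set_val @` P) (set_val x)].
  by apply: (filterS _ FP) => x Px; exists x.
have [y [[x Px <-] Wy]] := clp _ W FP' (open_nbhs_nbhs (conj oW Wp)).
by exists x; split => //; exact: WQ.
Qed.

HB.instance Definition _ :=
  Topological_isCompact.Build double_arrow double_arrow_compactT.

End double_arrow.

Section continuous_functions.
Variables (R : realType) (K : compactSpaceType).

(* C(K): a copy of [continuousType K R], on which the supremum norm is installed *)
Definition CK : Type := continuousType K R.

HB.instance Definition _ := Choice.on CK.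

Implicit Types (f g h : CK) (a b : R).

Definition CK_eval : CK -> K -> R := fun f => f : continuousType K R.
Coercion CK_eval : CK >-> Funclass.

Lemma CK_continuous f : continuous (f : K -> R).
Proof. exact: (@cts_fun _ _ (f : continuousType K R)). Qed.

Lemma CK_ext f g : f =1 g -> f = g.
Proof. by move=> fg; apply/continuousEP. Qed.

Lemma CK_zero_subproof : continuous (fun _ : K => 0 : R).
Proof. exact: cst_continuous. Qed.

Lemma CK_opp_subproof f : continuous (fun x => - f x).
Proof. by move=> x; apply: cvgN; exact: CK_continuous. Qed.

Lemma CK_add_subproof f g : continuous (fun x => f x + g x).
Proof. by move=> x; apply: cvgD; exact: CK_continuous. Qed.

Lemma CK_scale_subproof a f : continuous (fun x => a * f x).
Proof. by move=> x; apply: cvgMr; exact: CK_continuous. Qed.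

Definition CK_zero : CK := mkcts CK_zero_subproof : continuousType K R.
Definition CK_opp f : CK := mkcts (@CK_opp_subproof f) : continuousType K R.
Definition CK_add f g : CK := mkcts (@CK_add_subproof f g) : continuousType K R.
Definition CK_scale a f : CK := mkcts (@CK_scale_subproof a f) : continuousType K R.

Lemma CK_addA : associative CK_add.
Proof. by move=> f g h; apply: CK_ext => x; exact: addrA. Qed.

Lemma CK_addC : commutative CK_add.
Proof. by move=> f g; apply: CK_ext => x; exact: addrC. Qed.

Lemma CK_add0 : left_id CK_zero CK_add.
Proof. by move=> f; apply: CK_ext => x; exact: add0r. Qed.

Lemma CK_addN : left_inverse CK_zero CK_opp CK_add.
Proof. by move=> f; apply: CK_ext => x; exact: addNr. Qed.

HB.instance Definition _ :=
  GRing.isZmodule.Build CK CK_addA CK_addC CK_add0 CK_addN.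

Lemma CK_scaleA a b f : CK_scale a (CK_scale b f) = CK_scale (a * b) f.
Proof. by apply: CK_ext => x; exact: mulrA. Qed.

Lemma CK_scale1 : left_id 1 CK_scale.
Proof. by move=> f; apply: CK_ext => x; exact: mul1r. Qed.

Lemma CK_scaleDr : right_distributive CK_scale +%R.
Proof. by move=> a f g; apply: CK_ext => x; exact: mulrDr. Qed.

Lemma CK_scaleDl f : {morph CK_scale^~ f : a b / a + b}.
Proof. by move=> a b; apply: CK_ext => x; exact: mulrDl. Qed.

HB.instance Definition _ := GRing.Zmodule_isLmodule.Build R CK
  CK_scaleA CK_scale1 CK_scaleDr CK_scaleDl.

Definition sup_norm f : R := sup [set `|f x| | x in [set: K]].

Lemma sup_norm_has_ub f : has_ubound [set `|f x| | x in [set: K]].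
Proof.
have /compact_bounded [M [_ fM]] : compact ((f : K -> R) @` [set: K]).
  apply: continuous_compact (@compactT K).
  by apply: continuous_subspaceT; exact: CK_continuous.
exists (M + 1) => _ [x _ <-]; apply: (fM (M + 1)); first by rewrite ltrDl.
by exists x.
Qed.

Lemma ler_sup_norm f x : `|f x| <= sup_norm f.
Proof. by apply: ub_le_sup; [exact: sup_norm_has_ub|exists x]. Qed.

Lemma sup_norm_le f a : 0 <= a -> (forall x, `|f x| <= a) -> sup_norm f <= a.
Proof.
move=> a0 fa; rewrite /sup_norm; set S := [set _ | _ in _].
have [->|/set0P S0] := eqVneq S set0; first by rewrite sup0.
by apply: ge_sup => // _ [x _ <-].
Qed.

Lemma sup_norm_ge0 f : 0 <= sup_norm f.
Proof.
rewrite /sup_norm; set S := [set _ | _ in _].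
have [->|/set0P[_ [x _ _]]] := eqVneq S set0; first by rewrite sup0.
exact: le_trans (ler_sup_norm f x).
Qed.

Lemma sup_normD f g : sup_norm (f + g) <= sup_norm f + sup_norm g.
Proof.
apply: sup_norm_le => [|x]; first by rewrite addr_ge0 ?sup_norm_ge0.
by apply: le_trans (ler_normD _ _) _; rewrite lerD ?ler_sup_norm.
Qed.

Lemma sup_normZ a f : sup_norm (a *: f) = `|a| * sup_norm f.
Proof.
have le_normZ b g : sup_norm (b *: g) <= `|b| * sup_norm g.
  apply: sup_norm_le => [|x]; first by rewrite mulr_ge0 ?sup_norm_ge0.
  by rewrite [leLHS]normrM ler_wpM2l ?ler_sup_norm.
apply/eqP; rewrite eq_le le_normZ /=.
have [->|a0] := eqVneq a 0; first by rewrite normr0 mul0r sup_norm_ge0.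
rewrite -ler_pdivlMl ?normr_gt0 // -normfV.
by have := le_normZ a^-1 (a *: f); rewrite scalerA mulVf // scale1r.
Qed.

Lemma sup_norm_eq0 f : sup_norm f = 0 -> f = 0.
Proof.
move=> f0; apply: CK_ext => x; apply/eqP; rewrite -normr_le0 -f0.
exact: ler_sup_norm.
Qed.

HB.instance Definition _ := Lmodule_isNormed.Build R CK
  sup_normD sup_normZ sup_norm_eq0.

Lemma CK_complete (F : set_system CK) : ProperFilter F -> cauchy F -> cvg F.
Proof.
move=> FF /cauchy_ballP Fc.
have Fdist (e : R) : 0 < e ->
    \forall f & h \near F, forall x, `|(f : CK) x - (h : CK) x| < e.
  move=> e0; apply: filterS (Fc e e0) => -[f h] /=; rewrite -ball_normE => fh x.
  exact: le_lt_trans (ler_sup_norm (f - h) x) fh.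
have Fx x : cvg ((f : CK) x @[f --> F]).
  apply: R_complete; apply/cauchy_ballP => e e0.
  rewrite !near_map2; apply: filterS (Fdist e e0) => -[f h] /= /(_ x).
  by rewrite -ball_normE.
pose g x := lim ((f : CK) x @[f --> F]).
have Fg (e : R) : 0 < e -> \forall f \near F, forall x, `|g x - (f : CK) x| <= e.
  move=> e0; apply: filterS (nearP_dep (Fdist e e0)) => f Ffh x; rewrite distrC.
  have fg : `|f x - (h : CK) x| @[h --> F] --> `|f x - g x|.
    by apply: cvg_norm; apply: cvgB; [exact: cvg_cst|exact: Fx].
  by apply: (cvgr_to_le fg); apply: filterS Ffh => h /(_ x) /ltW.
have g_cts : continuous g.
  move=> x; apply/cvgrPdist_le => e e0; near F => f.
  have gf y : `|g y - f y| <= e / 3 by move: y; near: f; apply: Fg; exact: divr_gt0.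
  near=> y.
  have fxy : `|f x - f y| <= e / 3.
    near: y; have /cvgrPdist_le := @CK_continuous f x.
    by apply; exact: divr_gt0.
  have -> : g x - g y = (g x - f x) + (f x - f y) - (g y - f y) by ring.
  apply: le_trans (ler_normB _ _) _; apply: le_trans (lerD (ler_normD _ _) (lexx _)) _.
  by apply: le_trans (lerD (lerD (gf x) fxy) (gf y)) _; lra.
pose G : CK := mkcts g_cts : continuousType K R.
apply/cvg_ex; exists G; apply/cvgrPdist_le => e e0; near=> f.
apply: sup_norm_le; first exact: ltW.
by near: f; exact: Fg.
Unshelve. all: by end_near. Qed.

HB.instance Definition _ := Uniform_isComplete.Build CK CK_complete.

End continuous_functions.

Definition isomorphic (R : realType) (V W : normedModType R) : Prop :=
  exists (T : {linear V -> W}) (S : W -> V),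
    [/\ cancel T S, cancel S T, continuous T & continuous S].

(* Main.v *)
Require Import Defs.
From HB Require Import structures.
From mathcomp Require Import all_boot all_order all_algebra ring lra.
From mathcomp Require Import all_classical all_reals all_analysis.

(** Write S for the double arrow space and call h(t,1) - h(t,0) the gap of
    h : C(S) at t. Two facts describe C(S): only finitely many gaps of h exceed
    a given e > 0 ([finite_large_gaps]), so the gaps form a vector of c_0; and
    functions whose gaps are all at most e behave, up to a multiple of e, like
    elements of the separable space C[0,1], so that any uncountable family of
    them has two members within 5e of each other ([uncountable_small_gaps]).

    Let X be a compact space mapping onto a compact line L with uncountably many
    jumps, that is, points p having an immediate successor. Suppose that
    U : C(S x X) -> C(S) is linear, bounded and bounded below. Fix t. For each
    jump p of L the indicator q_p of {s >= (t,1)} x {x above p} is continuous,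
    and the gaps of the U q_p form an uncountable family in c_0. A Delta-system
    argument ([long_delta_system]) selects p_1 < ... < p_2n such that, up to a
    small error, every coordinate of these c_0-vectors is either constant along
    the family or nonzero at one member only. The function
    q_{p_1} + ... + q_{p_n} - q_{p_{n+1}} - ... - q_{p_2n} then has image with
    gaps bounded independently of n, whereas at points x lying between p_n and
    p_{n+1} it is n times the indicator of {s >= (t,1)}. Dividing by n gives f_t
    such that U f_t has arbitrarily small gaps, while f_t jumps from 0 to 1 at t
    along some slice ([slice_with_small_gaps]).

    This holds for each of the uncountably many t in (0,1), hence U f_t and
    U f_t' are close for two parameters t < t'. As U is bounded below, f_t and
    f_t' are close. But at ((t,1), x), for a suitable x, the first is 1 and the
    second is 0: a contradiction ([not_bounded_below]).

    It remains to see that a separable nonmetrizable compact line has uncountably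
    many jumps ([uncountable_jumps]): otherwise a countable dense set and the
    endpoints of the jumps provide countably many pairs d < e such that Urysohn
    functions for the half-lines below d and above e separate all points, and
    a compact space whose points are separated by countably many continuous
    functions is metrizable. The product of the lines maps onto each factor, so
    one factor is enough. *)

Set Implicit Arguments.
Unset Strict Implicit.
Unset Printing Implicit Defensive.

Import Order.TTheory GRing.Theory Num.Theory.
Import numFieldNormedType.Exports.

Local Open Scope classical_set_scope.
Local Open Scope ring_scope.

(** * Uncountable families of vectors of c_0 *)

Lemma uncountable_fiber (T : Type) (C : countType) (f : T -> C) (A : set T) :
  ~ countable A -> exists c, ~ countable (A `&` f @^-1` [set c]).
Proof.
move=> uA; apply: contrapT => /forallNP cA; apply: uA.
rewrite (_ : A = \bigcup_c (A `&` f @^-1` [set c])).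
  by apply: bigcup_countable => // c _; apply: contrapT; exact: cA.
by apply/seteqP; split => [x Ax|x [c _ []]//]; exists (f x).
Qed.

Lemma uncountableD (T : Type) (A B : set T) :
  ~ countable A -> countable B -> exists2 x, A x & ~ B x.
Proof.
move=> uA cB; apply: contrapT => nAB; apply: uA.
apply: sub_countable cB; apply: subset_card_le => x Ax.
by apply: contrapT => nBx; apply: nAB; exists x.
Qed.

Lemma same_floor_dist (R : realType) (e x y : R) :
  0 < e -> Num.floor (x / e) = Num.floor (y / e) -> `|x - y| <= e.
Proof.
move=> e0 xy.
have [x1 x2] : (Num.floor (x / e))%:~R * e <= x /\ x < (Num.floor (x / e) + 1)%:~R * e.
  by rewrite -ler_pdivlMr // -ltr_pdivrMr // floor_le floorD1_gt.
have [y1 y2] : (Num.floor (y / e))%:~R * e <= y /\ y < (Num.floor (y / e) + 1)%:~R * e.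
  by rewrite -ler_pdivlMr // -ltr_pdivrMr // floor_le floorD1_gt.
rewrite xy in x1 x2; rewrite intrD mulrDl mul1r in x2 y2.
by rewrite ler_norml; apply/andP; split; lra.
Qed.

Section almost_delta_systems.
Variables (R : realType) (J G : eqType) (v : J -> G -> R) (e : R).
Hypothesis e_gt0 : 0 < e.

Definition agree_on (A : set J) (D : set G) :=
  forall g, D g -> forall p q, A p -> A q -> `|v p g - v q g| <= e.

(** Induction on the number m of large coordinates outside D. If some further
    coordinate g is large at uncountably many members, restrict to those whose
    values at g lie in one cell of length e, and move g into D: one large
    coordinate fewer is left. *)
Lemma delta_kernel m (A : set J) (D : set G) :
  ~ countable A -> agree_on A D ->
  (forall p, A p -> exists2 s : seq G, (size s <= m)%N &
    forall g, ~ D g -> e < `|v p g| -> g \in s) ->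
  exists A' D', [/\ A' `<=` A, ~ countable A', agree_on A' D' &
    forall g, ~ D' g -> countable (A' `&` [set p | e < `|v p g|])].
Proof.
elim: m A D => [|m IH] A D uA AD As.
  exists A, D; split => // g nDg; apply: (sub_countable _ (countable0 J)).
  apply: subset_card_le => p [/As[s + sP]] /= ep.
  by rewrite leqn0 => /nilP s0; have := sP _ nDg ep; rewrite s0.
have [small|/existsNP[g /not_implyP[nDg uAg]]] :=
    pselect (forall g, ~ D g -> countable (A `&` [set p | e < `|v p g|])).
  by exists A, D; split => // ?.
have [c uAc] := uncountable_fiber (fun p => Num.floor (v p g / e)) uAg.
set Ac := (X in ~ countable X) in uAc.
have [||A' [D' [A'Ac uA' A'D' cA']]] := IH Ac (D `|` [set g]) uAc.
- move=> h [Dh p q [[Ap _] _] [[Aq _] _]|-> p q [_ pc] [_ qc]]; first exact: AD.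
  by apply: same_floor_dist => //; rewrite pc qc.
- move=> p [[Ap ep] _]; have [s sm sP] := As p Ap.
  exists (rem g s).
    by rewrite size_rem ?sP // -subn1 leq_subLR add1n.
  move=> h /not_orP[nDh hg] eh.
  have := sP h nDh eh; have gs := sP g nDg ep.
  by rewrite (perm_mem (perm_to_rem gs)) inE => /orP[/eqP|//].
- exists A', D'; split => // p /A'Ac; by case=> -[].
Qed.

Hypothesis finite_large : forall p, finite_set [set g | e < `|v p g|].

(** Outside the kernel D each coordinate is large at countably many members only,
    so members of s can be picked one at a time, avoiding the countably many that
    share a large coordinate with those already picked. *)
Lemma long_delta_system (A : set J) N : ~ countable A ->
  exists s : seq J, [/\ uniq s, size s = N, {in s, forall p, A p} &
    forall g, {in s &, forall p q, `|v p g - v q g| <= e} \/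
      {in s &, forall p q, e < `|v p g| -> e < `|v q g| -> p = q}].
Proof.
move=> uA.
have /choice[F FP] p : exists s : seq G, [set g | e < `|v p g|] = [set` s].
  exact/finite_seqP/finite_large.
(* on an uncountable subfamily the number of large coordinates is constant *)
have [m uAm] := uncountable_fiber (fun p => size (F p)) uA.
set Am := (X in ~ countable X) in uAm.
have [//||A' [D [A'A uA' A'D cA']]] := @delta_kernel m Am set0 uAm.
  move=> p [_ /= sm]; exists (F p); first by rewrite sm.
  by move=> g _ ep; have : [set g | e < `|v p g|] g by []; rewrite FP.
have sub p : A' p -> A p by move=> /A'A[].
suff [s [us sN sA sD]] : exists s : seq J, [/\ uniq s, size s = N,
    {in s, forall p, A' p} & forall g, ~ D g ->
      {in s &, forall p q, e < `|v p g| -> e < `|v q g| -> p = q}].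
  exists s; split => // [p ps|g]; first exact/sub/sA.
  have [Dg|/sD] := pselect (D g); last by right.
  by left => p q ps qs; apply: A'D => //; exact: sA.
elim: N => [|N [s [us sN sA sD]]]; first by exists [::]; split.
pose B := [set` s] `|` \bigcup_(q in [set` s]) \bigcup_(g in [set` F q] `\` D)
  (A' `&` [set p | e < `|v p g|]).
have cseq (T : eqType) (r : seq T) : countable [set` r].
  by apply: finite_set_countable; apply/finite_seqP; exists r.
have cB : countable B.
  rewrite /B -bigcup2E; apply: bigcup_countable => // -[|[|n]] _ //=.
  apply: bigcup_countable => // q qs; apply: bigcup_countable.
    by apply: sub_countable (cseq _ (F q)); apply: subset_card_le => g [].
  by move=> g [_ nDg]; exact: cA'.
have [p A'p /not_orP[/negP ps nBp]] := uncountableD uA' cB.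
have new q g : q \in s -> ~ D g -> e < `|v q g| -> e < `|v p g| -> False.
  move=> qs nDg eq ep; apply: nBp; exists q => //; exists g => //.
  by split => //; rewrite -FP.
exists (p :: s); split => /=; rewrite ?us ?sN ?andbT //.
  by move=> q; rewrite inE => /orP[/eqP->|/sA].
move=> g nDg q r; rewrite !inE => /orP[/eqP->|qs] /orP[/eqP->|rs] // eq er.
- by have := new _ _ rs nDg er eq.
- by have := new _ _ qs nDg eq er.
- exact: sD nDg _ _ qs rs eq er.
Qed.

End almost_delta_systems.

Lemma ler_sum_seq_norm (R : realType) (J : eqType) (w : J -> R) (s : seq J) e :
  {in s, forall p, `|w p| <= e} -> `|\sum_(p <- s) w p| <= (size s)%:R * e.
Proof.
elim: s => [|p s IH] we; first by rewrite big_nil normr0 mul0r.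
rewrite big_cons; apply: le_trans (ler_normD _ _) _.
rewrite /= -natr1 mulrDl mul1r addrC lerD ?we ?mem_head //.
by apply: IH => q qs; rewrite we // inE qs orbT.
Qed.

Lemma ler_sum_norm_one_large (R : realType) (J : eqType) (w : J -> R) (s : seq J) e C :
  0 <= e -> 0 <= C -> uniq s -> {in s, forall p, `|w p| <= C} ->
  {in s &, forall p q, e < `|w p| -> e < `|w q| -> p = q} ->
  \sum_(p <- s) `|w p| <= C + (size s)%:R * e.
Proof.
move=> e0 C0; elim: s => [|p s IH]; first by rewrite big_nil mul0r addr0.
move=> /andP[ps us] wC we; rewrite big_cons /= -natr1 mulrDl mul1r.
have [wp|wp] := leP `|w p| e.
  rewrite addrA addrC lerD // IH // => [q qs|q r qs rs].
    by apply: wC; rewrite inE qs orbT.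
  by apply: we; rewrite inE ?qs ?rs orbT.
apply: lerD; first by rewrite wC // mem_head.
rewrite ler_wpDr //.
rewrite -[leLHS]ger0_norm ?sumr_ge0 //.
apply: ler_sum_seq_norm => q qs; rewrite normr_id leNgt; apply/negP => wq.
have pq := we p q (mem_head _ _) _ wp wq.
by move: ps; rewrite pq ?inE ?qs ?orbT.
Qed.

(** Either the family is constant up to e, and the two sums of equal length cancel,
    or it has at most one entry larger than e. This is why the bound depends on n
    only through n * e. *)
Lemma balanced_sum_bound (R : realType) (J : eqType) (w : J -> R) (lo hi : seq J) n e C :
  0 <= e -> 0 <= C -> size lo = n -> size hi = n -> uniq (lo ++ hi) ->
  {in lo ++ hi, forall p, `|w p| <= C} ->
  {in lo ++ hi &, forall p q, `|w p - w q| <= e} \/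
  {in lo ++ hi &, forall p q, e < `|w p| -> e < `|w q| -> p = q} ->
  `|\sum_(p <- lo) w p - \sum_(p <- hi) w p| <= C + (n + n)%:R * e.
Proof.
move=> e0 C0 slo shi ulh wC [close|large]; last first.
  have := ler_sum_norm_one_large e0 C0 ulh wC large.
  rewrite size_cat slo shi; apply: le_trans.
  rewrite big_cat /=; apply: le_trans (ler_normB _ _) _.
  by rewrite lerD // ler_norm_sum.
apply: (@le_trans _ _ ((n + n)%:R * e)); last by rewrite lerDr.
case: lo => [|p0 lo] in slo ulh wC close *.
  move: shi; rewrite -slo => /size0nil ->.
  by rewrite !big_nil subrr normr0 mul0r.
have shift (s : seq J) : size s = n -> {subset s <= (p0 :: lo) ++ hi} ->
    `|\sum_(p <- s) w p - n%:R * w p0| <= n%:R * e.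
  move=> sn ss; have -> : n%:R * w p0 = \sum_(p <- s) w p0.
    by rewrite big_const_seq count_predT iter_addr_0 sn mulr_natl.
  rewrite -sumrB -sn; apply: ler_sum_seq_norm => p ps; apply: close; first exact: ss.
  exact: mem_head.
rewrite -(subrKA (n%:R * w p0)) natrD mulrDl; apply: le_trans (ler_normD _ _) _.
rewrite lerD //; first by apply: shift slo _ => p ps; rewrite mem_cat ps.
by rewrite distrC; apply: shift shi _ => p ps; rewrite mem_cat ps orbT.
Qed.

(** * Jumps of separable compact lines *)

Section metric_of_functions.
Variables (R : realType) (T : choiceType) (f : nat -> T -> R).
Hypothesis f_range : forall n x, 0 <= f n x <= 1.
Hypothesis f_inj : forall x y, (forall n, f n x = f n y) -> x = y.

(** The weights 1/(n+1) make the metric depend, up to any e > 0, on finitely many of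
    the functions; this yields its continuity. *)
Definition weighted_dist (x y : T) : R :=
  sup (range (fun n => `|f n x - f n y| / n.+1%:R)).

Lemma dist_term_le (x y : T) n : `|f n x - f n y| / n.+1%:R <= n.+1%:R^-1.
Proof.
rewrite ler_piMl // ler_norml.
by have /andP[? ?] := f_range n x; have /andP[? ?] := f_range n y; apply/andP; split; lra.
Qed.

Lemma le_weighted_dist (x y : T) n :
  `|f n x - f n y| / n.+1%:R <= weighted_dist x y.
Proof.
apply: ub_le_sup; last by exists n.
exists 1 => _ [m _ <-]; apply: le_trans (dist_term_le x y m) _.
by rewrite invf_le1 // ler1n.
Qed.

Lemma weighted_dist_le (x y : T) a :
  (forall n, `|f n x - f n y| / n.+1%:R <= a) -> weighted_dist x y <= a.
Proof.
move=> le_a; apply: ge_sup; first by exists (`|f 0 x - f 0 y| / 1%:R); exists 0%N.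
by move=> _ [n _ <-].
Qed.

(** A copy of T carrying the metric; it depends on the section hypotheses so that
    the metric structure can be inferred from it. *)
#[using="All"] Definition metric_of_functions : Type := T.

HB.instance Definition _ := Choice.on metric_of_functions.

Lemma weighted_distxx x : weighted_dist x x = 0.
Proof.
apply/eqP; rewrite eq_le; apply/andP; split.
  by apply: weighted_dist_le => n; rewrite subrr normr0 mul0r.
by apply: le_trans (le_weighted_dist x x 0); rewrite divr_ge0.
Qed.

Lemma weighted_dist_eq0 x y : weighted_dist x y = 0 -> x = y.
Proof.
move=> xy0; apply: f_inj => n; apply/eqP; rewrite -subr_eq0 -normr_le0.
by have := le_weighted_dist x y n; rewrite xy0 ler_pdivrMr // mul0r.
Qed.

Lemma weighted_distC x y : weighted_dist x y = weighted_dist y x.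
Proof.
by congr sup; apply/seteqP; split => _ [n _ <-]; exists n => //; rewrite distrC.
Qed.

Lemma weighted_dist_triangle y x z :
  weighted_dist x z <= weighted_dist x y + weighted_dist y z.
Proof.
apply: weighted_dist_le => n.
apply: le_trans (lerD (le_weighted_dist x y n) (le_weighted_dist y z n)).
by rewrite -mulrDl ler_pM2r ?invr_gt0 // ler_distD.
Qed.

HB.instance Definition _ := isMetric.Build R metric_of_functions
  weighted_distxx weighted_dist_eq0 weighted_distC weighted_dist_triangle.

End metric_of_functions.

Lemma continuous_weighted_dist (R : realType) (T : topologicalType)
    (f : nat -> T -> R) (x : T) (e : R) :
  (forall n x, 0 <= f n x <= 1) -> (forall n, continuous (f n)) -> 0 < e ->
  \forall y \near x, weighted_dist f x y < e.
Proof.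
move=> f01 cf e0; have e20 : 0 < e / 2 by exact: divr_gt0.
have [N _ NP] := @near_infty_natSinv_lt R (PosNum e20).
have : \forall y \near x, forall n : 'I_N, `|f n x - f n y| < e / 2.
  by apply: filter_forall => n; have /cvgrPdist_lt/(_ _ e20) := cf n x.
apply: filterS => y fxy.
apply: (@le_lt_trans _ _ (e / 2)); last by rewrite ltr_pdivrMr // ltr_pMr // ltr1n.
apply: weighted_dist_le => n; have [nN|Nn] := ltnP n N; last first.
  by apply: le_trans (dist_term_le f01 _ _ _) _; exact/ltW/NP.
apply: le_trans (ltW (fxy (Ordinal nN))).
by rewrite ler_piMr // invf_le1 // ler1n.
Qed.

(** The identity from T to T with the weighted metric is a continuous bijection from
    a compact space to a Hausdorff one. *)
Lemma metrizable_countable_separation (R : realType) (T : topologicalType)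
    (f : nat -> T -> R) :
  compact [set: T] ->
  (forall n x, 0 <= f n x <= 1) -> (forall n, continuous (f n)) ->
  (forall x y, (forall n, f n x = f n y) -> x = y) -> metrizable R T.
Proof.
move=> cT f01 cf f_inj; pose M : metricType R := metric_of_functions f01 f_inj.
exists M; pose toM (x : T) : M := x; pose ofM (x : M) : T := x.
have ctoM : continuous toM.
  move=> x; apply/cvg_ballP => e e0.
  by apply: filterS (continuous_weighted_dist x f01 cf e0) => y; rewrite ballEmdist.
exists toM, ofM; split => //; apply/continuous_closedP => A cA.
apply: compact_closed; first exact: metric_hausdorff.
rewrite (_ : ofM @^-1` A = toM @` A); last first.
  by apply/seteqP; split => [x Ax|_ [x Ax <-]]; [exists x|].
apply: continuous_compact; first exact: continuous_subspaceT.
exact: subclosed_compact cA cT _.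
Qed.

Definition is_jump d (L : orderType d) (p : L) :=
  exists2 q, (p < q)%O & forall r, ~~ (p < r < q)%O.

(** P consists of the pairs d < e taken from a dense set together with the two
    sides of all jumps. Given x < y, either two points of the dense set lie strictly
    between x and y, or x is a jump whose successor is at most y. *)
Lemma separating_pairs d (L : orderTopologicalType d) :
  separable L -> countable (@is_jump d L) ->
  exists2 P : set (L * L), countable P & (forall p, P p -> (p.1 < p.2)%O) /\
    forall x y, (x < y)%O -> exists2 p, P p & (x <= p.1)%O /\ (p.2 <= y)%O.
Proof.
move=> [D cD dD] cJ.
have /choice[succ succP] (p : L) : exists q, is_jump p ->
    (p < q)%O /\ forall r, ~~ (p < r < q)%O.
  by have [[q pq qP]|np] := pselect (is_jump p); [exists q|exists p].
pose E : set L := D `|` (@is_jump d L) `|` (succ @` (@is_jump d L)).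
exists ((E `*` E) `&` [set p | (p.1 < p.2)%O]).
  have cE : countable E.
    rewrite /E -bigcup2E; apply: bigcup_countable => // -[|[|n]] _ //=.
      by rewrite -bigcup2E; apply: bigcup_countable => // -[|[|n]] _ //=.
    by apply: sub_countable cJ; exact: card_image_le.
  by apply: sub_countable (countableX cE cE); apply: subset_card_le => ? [].
split => [p []//|x y xy].
have ED z : D z -> E z by left; left.
have EJ z : is_jump z -> E z by left; right.
have ES z : is_jump z -> E (succ z) by move=> jz; right; exists z.
have step (u w : L) : (u < w)%O -> (is_jump u /\ (succ u <= w)%O) \/
    exists2 z, D z & (u < z < w)%O.
  move=> uw; have [[z [Dz]]|nD] := pselect (D `&` `]u, w[%classic !=set0).
    by rewrite /= in_itv /= => uzw; right; exists z.
  have nuw r : ~~ (u < r < w)%O.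
    apply/negP => urw; apply: nD; rewrite setIC; apply: dD; last exact: itv_open.
    by exists r; rewrite /= in_itv.
  left; have ju : is_jump u by exists w.
  split => //; have [us sP] := succP u ju.
  by rewrite leNgt; apply/negP => wsu; have := sP w; rewrite uw wsu.
have [[jx sx]|[z Dz /andP[xz zy]]] := step _ _ xy.
  exists (x, succ x) => //=; split => //=; last by have [] := succP x jx.
  by split => /=; [exact: EJ|exact: ES].
have [[jx sx]|[t Dt /andP[xt tz]]] := step _ _ xz.
  exists (x, succ x) => //=.
    by split => /=; [split; [exact: EJ|exact: ES]|have [] := succP x jx].
  by split => //; exact: le_trans sx (ltW zy).
by exists (t, z) => /=; split => //=; [split; exact: ED|exact: ltW|exact: ltW].
Qed.

Lemma uncountable_jumps (R : realType) d (L : compactLineType d) :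
  separable L -> ~ metrizable R L -> ~ countable (@is_jump d L).
Proof.
move=> sL nmL cJ; apply: nmL.
have [P cP [Plt Psep]] := separating_pairs sL cJ.
have /countable_injP[g g_inj] := cP.
have nL : normal_space L.
  apply: compact_normal; [exact: order_hausdorff|exact: compactT].
have sep (p : L * L) : P p -> exists h : L -> R, [/\ continuous h,
    forall x, 0 <= h x <= 1, forall x, (x <= p.1)%O -> h x = 0 &
    forall x, (p.2 <= x)%O -> h x = 1].
  move=> Pp; have [|h [ch h01 h0 h1]] := (@uniform_separatorP L R
      `]-oo, p.1]%classic `[p.2, +oo[%classic).1.
    apply: normal_uniform_separator => //; first exact: lray_closed.
      exact: rray_closed.
    apply/seteqP; split => // x []; rewrite /= !in_itv /= andbT => xp px.
    by have := Plt _ Pp; rewrite ltNge (le_trans px xp).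
  exists h; split => // x.
  - by have := h01 (h x) (ex_intro2 _ _ x I erefl); rewrite /= in_itv.
  - by move=> xp; apply: h0; exists x => //; rewrite /= in_itv.
  - by move=> px; apply: h1; exists x => //; rewrite /= in_itv /= andbT.
have /choice[f fP] n : exists h : L -> R, [/\ continuous h,
    forall x, 0 <= h x <= 1 & forall p, P p -> g p = n ->
    (forall x, (x <= p.1)%O -> h x = 0) /\ (forall x, (p.2 <= x)%O -> h x = 1)].
  have [[p Pp gp]|nP] := pselect (exists2 p, P p & g p = n).
    have [h [ch h01 h0 h1]] := sep p Pp; exists h; split => // q Pq gq.
    by rewrite (g_inj q p) ?inE // gp gq.
  exists (fun=> 0); split => [|x|p Pp gp]; first exact: cst_continuous.
    by rewrite lexx ler01.
  by case: nP; exists p.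
apply: (@metrizable_countable_separation R L f (@compactT L)) => [n|n|x y fxy].
- by have [] := fP n.
- by have [] := fP n.
apply: contrapT => /eqP; rewrite neq_lt.
wlog xy : x y fxy / (x < y)%O.
  by move=> wl /orP[xy|yx]; [apply: (wl x y)|apply: (wl y x)]; rewrite ?xy ?yx.
move=> _; have [p Pp [xp py]] := Psep x y xy.
have [_ _ /(_ p Pp erefl)[h0 h1]] := fP (g p).
by have := fxy (g p); rewrite h0 // h1 // => /eqP; rewrite eq_sym oner_eq0.
Qed.

(** * Gaps of continuous functions on the double arrow space *)

Lemma continuous_bool (R : realType) (T : topologicalType) (P : pred T) :
  open [set x | P x] -> open [set x | ~~ P x] ->
  continuous (fun x => (P x)%:R : R).
Proof.
move=> oP onP x; apply: cvg_near_cst.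
have [Px|nPx] := boolP (P x).
  by apply: filterS (open_nbhs_nbhs (conj oP Px)) => y /= ->.
by apply: filterS (open_nbhs_nbhs (conj onP nPx)) => y /= /negbTE ->.
Qed.

Lemma continuous_dist_ltP (R : realType) (T : topologicalType) (f : T -> R) :
  continuous f <->
  forall x e, 0 < e -> nbhs x [set y | `|f x - f y| < e].
Proof.
split=> [cf x e e0|cf x]; first by have /cvgrPdist_lt/(_ _ e0) := cf x.
by apply/cvgrPdist_lt => e e0; exact: cf.
Qed.

Lemma itv_mem_between d (T : porderType d) (i : interval T) (x y z : T) :
  (x <= y)%O -> (y <= z)%O -> x \in i -> z \in i -> y \in i.
Proof.
case: i => l r; move=> xy yz; rewrite !itv_boundlr => /andP[lx _] /andP[_ zr].
by rewrite (le_trans lx) ?(le_trans _ zr) ?bnd_simp.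
Qed.

Section double_arrow_functions.
Variable R : realType.
Local Notation S := (double_arrow R).
Local Notation SI := (split_interval R).

Definition open_unit : Type := {t : R | 0 < t < 1}.
HB.instance Definition _ := SubChoice.on open_unit.

Implicit Types (s : S) (t : open_unit) (b : bool).

Definition position s : R := val (set_val s : SI).1.

Lemma position_ge0 s : 0 <= position s.
Proof. by rewrite /position; case: (set_val s : SI).1 => x /= /andP[]. Qed.

Lemma position_le1 s : position s <= 1.
Proof. by rewrite /position; case: (set_val s : SI).1 => x /= /andP[]. Qed.

Lemma open_unit_itv t : 0 <= val t <= 1.
Proof. by case: t => t /= /andP[t0 t1]; rewrite !ltW. Qed.

Lemma half_unit_subproof : 0 < (2^-1 : R) < 1.
Proof. by rewrite invr_gt0 ltr0n invf_lt1 ?ltr1n ?ltr0n. Qed.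

Definition half_unit : open_unit :=
  exist (fun x : R => 0 < x < 1) _ half_unit_subproof.

Definition split_twin t b : SI := (exist _ (val t) (open_unit_itv t), b).

Lemma split_twin_inner t b : split_twin t b <> split_min R /\ split_twin t b <> split_max R.
Proof.
by split=> -[] t01 _; have := valP t; rewrite /= t01 ltxx ?andbF.
Qed.

Definition twin t b : S := exist _ (split_twin t b) (mem_set (split_twin_inner t b)).

(** Over 0 and over 1 one of the two points of the split interval has been removed,
    so only positions in (0,1) are shared by two points. *)
Lemma eq_position s s' : position s = position s' ->
  s = s' \/ exists t b, s = twin t b /\ s' = twin t (~~ b).
Proof.
have mk s0 t : position s0 = val t -> s0 = twin t (set_val s0 : SI).2.
  move=> st; apply: val_inj => /=; rewrite /split_twin.
  case: s0 st => -[x i] /= xP xt.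
  by congr pair; apply: val_inj.
move=> ss'; have [ij|ij] := eqVneq (set_val s : SI).2 (set_val s' : SI).2.
  left; apply: val_inj; move: ss' ij; rewrite /position /=.
  case: s => -[x i] /= xP; case: s' => -[y j] /= yP xy ij.
  by congr pair => //; apply: val_inj.
right; have t01 : 0 < position s < 1.
  rewrite !lt_neqAle position_ge0 position_le1 !andbT.
  have [s1 s2] := set_valP s; have [s1' s2'] := set_valP s'.
  move: ss' ij s1 s2 s1' s2'; rewrite /position /=.
  case: s => -[x i] /= xP; case: s' => -[y j] /= yP xy ij.
  have <- : x = y by exact: val_inj.
  move=> s1 s2 s1' s2'; apply/andP; split; apply/negP => /eqP xE.
    have x0 : x = ui0 R by apply: val_inj; rewrite /= -xE.
    by case: i j ij s1 s1' {xP yP s2 s2'} => -[] // _; rewrite x0.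
  have x1 : x = ui1 R by apply: val_inj.
  by case: i j ij s2 s2' {xP yP s1 s1'} => -[] // _; rewrite x1.
exists (exist (fun x : R => 0 < x < 1) _ t01), (set_val s : SI).2; split; first exact: mk.
rewrite (_ : ~~ _ = (set_val s' : SI).2); last first.
  by move: ij; case: (_.2); case: (_.2).
exact: mk.
Qed.

(** The half-lines {position > l} and {position < u} are traces of open rays with
    endpoints (l,1) and (u,0); for l < 0 or u > 1 there is no such point but then the
    half-line is everything. *)
Lemma continuous_position : continuous position.
Proof.
have val_cts : continuous (set_val : S -> SI) by exact: initial_continuous.
have lt_near s (l : R) : l < position s -> \forall s' \near s, l < position s'.
  move=> ls; have [l0|l0] := ltP l 0.
    by apply: (@nearW _ _ _ (nbhs_filter s)) => s'; apply: lt_le_trans l0 _; exact: position_ge0.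
  have l01 : 0 <= l <= 1 by rewrite l0 (le_trans (ltW ls)) // position_le1.
  pose p : SI := (exist _ l l01, true).
  have : \forall s' \near s, (p < set_val s')%O.
    have /val_cts : \forall q \near (set_val s : SI), (p < q)%O.
      have : (`]p, +oo[%classic : set SI) (set_val s).
        by rewrite /= in_itv /= andbT lt_split /= (ltW ls) /= leNgt ls.
      move=> /(conj (rray_open p))/open_nbhs_nbhs; apply: filterS => q.
      by rewrite /= in_itv /= andbT.
    by [].
  apply: (@filterS _ _ (nbhs_filter s)) => s'; rewrite lt_split /= -/(position s') => /andP[].
  by rewrite le_eqVlt => /orP[/eqP->|//]; rewrite lexx /=; case: (_.2).
have gt_near s (u : R) : position s < u -> \forall s' \near s, position s' < u.
  move=> su; have [u1|u1] := ltP 1 u.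
    by apply: (@nearW _ _ _ (nbhs_filter s)) => s'; apply: le_lt_trans u1; exact: position_le1.
  have u01 : 0 <= u <= 1 by rewrite u1 (le_trans _ (ltW su)) // position_ge0.
  pose p : SI := (exist _ u u01, false).
  have : \forall s' \near s, (set_val s' < p)%O.
    have /val_cts : \forall q \near (set_val s : SI), (q < p)%O.
      have : (`]-oo, p[%classic : set SI) (set_val s).
        by rewrite /= in_itv /= lt_split /= (ltW su) /= leNgt su.
      move=> /(conj (lray_open p))/open_nbhs_nbhs; apply: filterS => q.
      by rewrite /= in_itv /=.
    by [].
  apply: (@filterS _ _ (nbhs_filter s)) => s'; rewrite lt_split /= -/(position s') => /andP[].
  by rewrite le_eqVlt => /orP[/eqP->|//]; rewrite lexx /=; case: (_.2).
apply/continuous_dist_ltP => s e e0.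
have se : position s - e < position s by rewrite ltrBlDr ltrDl.
have es : position s < position s + e by rewrite ltrDl.
apply: (@filterS2 _ _ (nbhs_filter s) _ _ _ _ (lt_near _ _ se) (gt_near _ _ es)) => s' h1 h2.
by rewrite /= ltr_norml; apply/andP; split; lra.
Qed.

(** The half-line {s >= (t,1)}; it is clopen because (t,1) is the successor of (t,0). *)
Definition after_cut t s : bool := (split_twin t false < set_val s)%O.

Lemma continuous_after_cut t : continuous (fun s => (after_cut t s)%:R : R).
Proof.
have val_cts : continuous (set_val : S -> SI) by exact: initial_continuous.
apply: continuous_bool.
  rewrite (_ : mkset _ = set_val @^-1` `]split_twin t false, +oo[%classic).
    by apply: open_comp; [move=> x _; exact: val_cts|exact: rray_open].
  by apply/seteqP; split => s; rewrite /= in_itv /= andbT.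
rewrite (_ : mkset _ = set_val @^-1` `]-oo, split_twin t true[%classic).
  by apply: open_comp; [move=> x _; exact: val_cts|exact: lray_open].
apply/seteqP; split => s; rewrite /= in_itv /= /after_cut !lt_split /=.
  by rewrite -/(position s); case: (ltgtP (val t) (position s)) => //= _; case: (_.2).
by rewrite -/(position s); case: (ltgtP (val t) (position s)) => //= _; case: (_.2).
Qed.

Lemma after_cut_twin t t' : after_cut t (twin t' true) = (val t <= val t').
Proof. by rewrite /after_cut lt_split /= andb_idr // => _; rewrite implybT. Qed.

Definition gap (h : S -> R) t : R := h (twin t true) - h (twin t false).

(** Compactness, in the form of near coverings, for the filter of sets containing all
    but finitely many t with a large gap. Around each s take an order interval on
    which h oscillates less than e: if (t1,0) and (t2,0) belong to it with t1 < t2,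
    so does (t1,1), and the gap at t1 is small. Hence the interval contains (t,0)
    for at most one t with a large gap. *)
Lemma finite_large_gaps (h : S -> R) (e : R) : continuous h -> 0 < e ->
  finite_set [set t | e < `|gap h t|].
Proof.
move=> ch e0; have e20 : 0 < e / 2 by exact: divr_gt0.
pose B := [set t | e < `|gap h t|].
pose F : set_system open_unit := fun X => finite_set (B `\` X).
have FF : Filter F.
  split; first by rewrite /F setDT.
    by move=> X Y FX FY; rewrite /F setDIr; rewrite finite_setU.
  by move=> X Y XY; apply: sub_finite_set => t [Bt nYt]; split => // /XY.
have nearF := (compact_near_coveringP [set: S]).1 (@compactT S) open_unit F
  (fun t s => s <> twin t false) FF.
suff /nearF : forall s, setT s ->
    \forall s' \near s & t \near F, s' <> twin t false.
  rewrite /F; apply: sub_finite_set => t Bt; split => // /(_ (twin t false) I).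
  exact.
move=> s _.
have [_ [[W oW <-] /= Ws WP]] := (continuous_dist_ltP h).1 ch s _ e20.
have := open_nbhs_nbhs (conj oW Ws); rewrite itv_nbhsE => -[i [oi si] iW].
have osc s' : set_val s' \in i -> `|h s - h s'| < e / 2.
  by move=> s'i; apply: WP; exact: iW.
have no_lt t1 t2 : B t1 -> split_twin t1 false \in i ->
    split_twin t2 false \in i -> val t1 < val t2 -> False.
  move=> e1 i1 i2 lt12.
  have i1' : split_twin t1 true \in i.
    have c1 : (split_twin t1 false <= split_twin t1 true)%O.
      by rewrite le_split /= lexx.
    have c2 : (split_twin t1 true <= split_twin t2 false)%O.
      by rewrite le_split /= (ltW lt12) leNgt lt12.
    exact: itv_mem_between c1 c2 i1 i2.
  have := osc (twin t1 false) i1; have := osc (twin t1 true) i1' => o1 o2.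
  move: e1; rewrite /B /= ltNge => /negP; apply; rewrite /gap.
  rewrite -(subrKA (h s)) (splitr e); apply: le_trans (ler_normD _ _) _.
  by rewrite lerD // ltW // distrC.
exists (set_val @^-1` [set` i], [set t | split_twin t false \notin i]) => /=.
  split.
    apply: open_nbhs_nbhs; split => //; apply: open_comp.
      by move=> x _; exact: initial_continuous.
    exact: itv_open_ends_open.
  pose B' := B `&` [set t | split_twin t false \in i].
  apply: (@sub_finite_set _ _ B').
    by move=> t [Bt /negP/negPn ti]; split.
  have [->|/set0P[t [Bt ti]]] := eqVneq B' set0; first exact: finite_set0.
  apply: (@sub_finite_set _ _ [set t]); last exact: finite_set1.
  move=> t' [Bt' ti']; apply: val_inj; apply: contrapT => /eqP.
  by rewrite neq_lt => /orP[] /no_lt; exact.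
by move=> [s' t] /= [s'i ti] s't; move: ti s'i; rewrite s't => /negP.
Qed.

(** On the compact set of pairs with |h s - h s'| >= 2e the distance of positions has
    a positive minimum, since distinct points with equal positions are (t,0), (t,1)
    and there the values of h differ by a gap, hence by at most e. *)
Lemma small_gaps_oscillation (h : S -> R) (e : R) : continuous h -> 0 < e ->
  (forall t, `|gap h t| <= e) -> exists n : nat, forall s s',
    `|position s - position s'| < n.+1%:R^-1 -> `|h s - h s'| <= 2 * e.
Proof.
move=> ch e0 he.
pose A : set (S * S) := [set p | 2 * e <= `|h p.1 - h p.2|].
have cdist (f : S -> R) : continuous f -> continuous (fun p : S * S => `|f p.1 - f p.2|).
  move=> cf p; apply: cvg_norm; apply: cvgB.
    by apply: (continuous_comp (g := f)); [exact: cvg_fst|exact: cf].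
  by apply: (continuous_comp (g := f)); [exact: cvg_snd|exact: cf].
have cA : compact A.
  apply: subclosed_compact (@prod_compactT S S) _ => //.
  apply: (@preimage_closed _ _ (fun p : S * S => `|h p.1 - h p.2|) [set r | 2 * e <= r]).
    by move=> p _; exact: cdist.
  exact: closed_ge.
have [A0|/set0P An0] := eqVneq A set0.
  exists 0%N => s s' _; apply/ltW; rewrite ltNge; apply/negP => ss'.
  by have : A (s, s') by []; rewrite A0.
have [|[a b] /set_mem Aab cmin] := compact_EVT_min
    (f := fun p : S * S => `|position p.1 - position p.2|) An0 cA.
  by apply: continuous_subspaceT; exact: cdist continuous_position.
have {}Aab : 2 * e <= `|h a - h b| := Aab.
have ab0 : 0 < `|position a - position b|.
  rewrite normr_gt0 subr_eq0; apply/eqP => /eq_position [ab|[t [c [at_ bt]]]].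
    by move: Aab; rewrite ab subrr normr0 leNgt mulr_gt0.
  have : `|h a - h b| <= e.
    rewrite at_ bt; have := he t; rewrite /gap.
    by case: c {at_ bt} => //; rewrite distrC.
  by apply/negP; rewrite -ltNge (lt_le_trans _ Aab) // ltr_pMl // ltr1n.
have [N _ NP] := @near_infty_natSinv_lt R (PosNum ab0).
exists N => s s' ss'; apply/ltW; rewrite ltNge; apply/negP => ss'2.
have := cmin (s, s') (mem_set ss'2); apply/negP; rewrite -ltNge /=.
by rewrite (lt_trans ss') //; exact: (NP N (leqnn N)).
Qed.

(** By [small_gaps_oscillation] each h x is known up to 5e from its modulus n x and the
    rounded values at one point in each of n x + 2 cells of length 1/(n x + 1): these
    data range over a countable set, so they coincide for two members. The constant
    is 2e + e + 2e. *)
Lemma uncountable_small_gaps (X : Type) (A : set X) (h : X -> S -> R) (e : R) :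
  ~ countable A -> 0 < e -> (forall x, A x -> continuous (h x)) ->
  (forall x, A x -> forall t, `|gap (h x) t| <= e) ->
  exists x y, [/\ A x, A y, x <> y & forall s, `|h x s - h y s| <= 5 * e].
Proof.
move=> uA e0 ch he.
pose cell n s : nat := Num.truncn (position s * n.+1%:R).
have cell_dist n s s' : cell n s = cell n s' ->
    `|position s - position s'| < n.+1%:R^-1.
  move=> ss'; have n0 : 0 < n.+1%:R :> R by rewrite ltr0n.
  have : 0 <= position s * n.+1%:R by rewrite mulr_ge0 ?position_ge0.
  have : 0 <= position s' * n.+1%:R by rewrite mulr_ge0 ?position_ge0.
  move=> /truncn_itv /andP[+ +] /truncn_itv /andP[]; rewrite -/(cell n s) -/(cell n s') ss'.
  rewrite -div1r ltr_pdivlMr // -(gtr0_norm n0) -normrM (gtr0_norm n0) mulrBl.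
  rewrite -natr1 => *.
  by rewrite ltr_norml; apply/andP; split; lra.
have cell_le n s : (cell n s < n.+2)%N.
  have : 0 <= position s * n.+1%:R by rewrite mulr_ge0 ?position_ge0.
  move=> /truncn_itv /andP[+ _]; rewrite -/(cell n s) ltnS -(ler_nat R) => cs.
  by apply: le_trans cs _; rewrite ler_piMl // position_le1.
(* a sample point in each nonempty cell *)
have /choice[rep repP] (nk : nat * nat) : exists r, forall s,
    cell nk.1 s = nk.2 -> cell nk.1 r = nk.2.
  have [[s sk]|nk0] := pselect (exists s, cell nk.1 s = nk.2); first by exists s.
  by exists (twin half_unit true) => s sk; case: nk0; exists s.
have /choice[n nP] x : exists n : nat, A x -> forall s s',
    `|position s - position s'| < n.+1%:R^-1 -> `|h x s - h x s'| <= 2 * e.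
  have [Ax|nAx] := pselect (A x); last by exists 0%N.
  by have [n nP] := small_gaps_oscillation (ch x Ax) e0 (he x Ax); exists n.
pose samples x := mkseq (fun k => Num.floor (h x (rep (n x, k)) / e)) (n x).+2.
pose code x := (n x, samples x).
have [c uAc] := uncountable_fiber code uA.
have [x [Ax cx] _] := uncountableD uAc (countable0 X).
have [y [Ay cy] yx] := uncountableD uAc (countable1 x).
exists x, y; split => // [xy|s]; first exact/yx/esym.
have cxy : code x = code y by rewrite cx cy.
have nxy : n x = n y := congr1 fst cxy.
pose r := rep (n x, cell (n x) s).
have rs : `|position s - position r| < (n x).+1%:R^-1.
  by apply: cell_dist; apply/esym; exact: repP (n x, cell (n x) s) s erefl.
have xr := nP x Ax s r rs.
have yr : `|h y s - h y r| <= 2 * e by apply: nP => //; rewrite -nxy.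
have xyr : `|h x r - h y r| <= e.
  apply: same_floor_dist => //.
  have : samples x = samples y := congr1 snd cxy.
  move=> /(congr1 (fun c => nth 0 c (cell (n x) s))).
  by rewrite !nth_mkseq -?nxy ?cell_le.
have -> : h x s - h y s = (h x s - h x r) + (h x r - h y r) - (h y s - h y r).
  by ring.
apply: le_trans (ler_normB _ _) _.
apply: le_trans (lerD (ler_normD _ _) (lexx _)) _.
by apply: le_trans (lerD (lerD xr xyr) yr) _; lra.
Qed.

End double_arrow_functions.

Lemma uncountable_open_unit (R : realType) : ~ countable [set: open_unit R].
Proof.
move=> cU; have c01 : countable (`]0, 1[%classic : set R).
  apply: sub_countable cU; apply: (card_le_trans _ (card_image_le val _)).
  apply: subset_card_le => x; rewrite /= in_itv /= => x01.
  by exists (exist (fun x : R => 0 < x < 1) x x01).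
have := countable_lebesgue_measure0 c01.
rewrite lebesgue_measure_itv /= lte_fin ltr01 sube0 => -[] /eqP.
by rewrite oner_eq0.
Qed.

(** * Linear maps from C(S x X) to C(S) *)

Lemma isomorphic_bounds (R : realType) (V W : normedModType R) :
  isomorphic V W -> exists (U : {linear W -> V}) (M : R), [/\ 0 < M,
    forall w, `|U w| <= M * `|w| & forall w, `|w| <= M * `|U w|].
Proof.
move=> [T [S [TK SK cT cS]]].
have bounded (X Y : normedModType R) (f : {linear X -> Y}) : continuous f ->
    \forall r \near +oo, forall x, `|f x| <= r * `|x|.
  by move=> cf; apply/linear_boundedP/continuous_linear_bounded/cf.
pose U : {linear W -> V} :=
  HB.pack S (GRing.isLinear.Build R W V _ S (GRing.can2_linear TK SK)).
have bT := bounded _ _ T cT; have bU := bounded _ _ U cS.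
near (pinfty_nbhs R) => M; exists U, M; split => [|w|w].
- by near: M; exact: nbhs_pinfty_gt.
- by move: w; near: M.
- suff : `|T (S w)| <= M * `|S w| by rewrite SK.
  by move: (S w); near: M.
Unshelve. all: by end_near. Qed.

Lemma CK_sumE (R : realType) (X : compactSpaceType) (J : Type) (s : seq J)
    (f : J -> CK R X) (x : X) :
  (\sum_(j <- s) f j : CK R X) x = \sum_(j <- s) f j x.
Proof. by elim/big_rec2: _ => // j y1 y2 _ <-. Qed.

Lemma ler_CK_norm (R : realType) (Y : compactSpaceType) (f : CK R Y) y : `|f y| <= `|f|.
Proof. exact: ler_sup_norm. Qed.

Lemma CK_norm_le (R : realType) (Y : compactSpaceType) (f : CK R Y) a :
  0 <= a -> (forall y, `|f y| <= a) -> `|f| <= a.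
Proof. exact: sup_norm_le. Qed.

Section gap_linear.
Variable R : realType.
Local Notation CS := (CK R (double_arrow R)).
Implicit Types (f g : CS) (t : open_unit R).

Lemma gapZ a f t : gap (a *: f : CS) t = a * gap f t.
Proof. by rewrite /gap mulrBr. Qed.

Lemma gapB f g t : gap (f - g : CS) t = gap f t - gap g t.
Proof.
transitivity ((f (twin t true) - g (twin t true)) -
  (f (twin t false) - g (twin t false))); first by [].
by rewrite /gap; ring.
Qed.

Lemma gap_sum (J : Type) (s : seq J) (f : J -> CS) t :
  gap (\sum_(j <- s) f j : CS) t = \sum_(j <- s) gap (f j) t.
Proof. by rewrite /gap !CK_sumE -sumrB. Qed.

Lemma gap_le f t : `|gap f t| <= 2 * `|f|.
Proof.
rewrite /gap; apply: le_trans (ler_normB _ _) _.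
by rewrite mulr_natl mulr2n lerD // ler_CK_norm.
Qed.

End gap_linear.

Section embedding.
Variables (R : realType) (X : compactSpaceType) (d : Order.disp_t).
Variables (L : compactLineType d) (pi : X -> L).
Hypothesis pi_cts : continuous pi.
Hypothesis pi_surj : forall y, exists x, pi x = y.
Hypothesis L_jumps : ~ countable (@is_jump d L).

Local Notation S := (double_arrow R).
Variables (U : {linear CK R (S * X)%type -> CK R S}) (M : R).
Hypothesis M_gt0 : 0 < M.
Hypothesis U_bounded : forall f, `|U f| <= M * `|f|.

(** Continuity uses that above p is the closed half-line starting at the successor of
    the jump p. *)
Lemma quadrant (t : open_unit R) (p : L) : is_jump p ->
  exists f : CK R (S * X)%type,
    forall z, f z = (after_cut t z.1)%:R * ((p < pi z.2)%O)%:R.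
Proof.
move=> [q pq nr].
have cp : continuous (fun y : L => ((p < y)%O)%:R : R).
  apply: continuous_bool.
    rewrite (_ : mkset _ = `]p, +oo[%classic); first exact: rray_open.
    by apply/seteqP; split => y; rewrite /= in_itv /= andbT.
  rewrite (_ : mkset _ = `]-oo, q[%classic); first exact: lray_open.
  apply/seteqP; split => y; rewrite /= in_itv /=; rewrite -leNgt.
    by move=> yp; exact: le_lt_trans yp pq.
  by move=> yq; rewrite leNgt; apply/negP => py; have := nr y; rewrite py yq.
have cpp : continuous ((fun y : L => ((p < y)%O)%:R : R) \o pi).
  by move=> x; apply: continuous_comp; [exact: pi_cts|exact: cp].
have cf : continuous (fun z : S * X =>
    (after_cut t z.1)%:R * ((p < pi z.2)%O)%:R : R).
  move=> z; apply: cvgM.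
    apply: (continuous_comp (g := fun s => (after_cut t s)%:R : R)).
      exact: cvg_fst.
    exact: continuous_after_cut.
  apply: (continuous_comp (f := snd) (g := fun x => ((p < pi x)%O)%:R : R)).
    exact: cvg_snd.
  exact: cpp.
by exists (mkcts cf : continuousType _ _).
Qed.

(** The average of n quadrants minus the average of n others attached to higher jumps:
    between the two groups it is the indicator of a half-line of S, while the gaps
    of its image are of order 1/n by [balanced_sum_bound]. *)
Lemma slice_with_small_gaps (t : open_unit R) (e : R) : 0 < e ->
  exists f : CK R (S * X)%type, [/\ forall t', `|gap (U f) t'| <= e,
    exists x, forall s, f (s, x) = (after_cut t s)%:R &
    forall s x, ~~ after_cut t s -> f (s, x) = 0].
Proof.
move=> e0.
have /choice[q qE] (p : L) : exists f : CK R (S * X)%type, is_jump p ->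
    forall z, f z = (after_cut t z.1)%:R * ((p < pi z.2)%O)%:R.
  have [/(quadrant t)[f fE]|np] := pselect (is_jump p); first by exists f.
  by exists 0.
pose v p t' := gap (U (q p)) t'.
have v_le p t' : is_jump p -> `|v p t'| <= 2 * M.
  move=> jp; apply: le_trans (gap_le _ _) _; rewrite ler_wpM2l //.
  apply: le_trans (U_bounded _) _; rewrite ler_piMr //; first exact: ltW.
  apply: CK_norm_le => // z; rewrite qE //.
  by case: (after_cut _ _); case: (_ < _)%O; rewrite ?mulr0 ?mul0r ?mulr1 ?normr0 ?normr1.
(* 2M bounds the gaps of every U (q p), and 1 is the total error allowed below *)
have [n n0 ne] : exists2 n : nat, (0 < n)%N & (2 * M + 1) / n%:R <= e.
  have M10 : 0 < 2 * M + 1 by rewrite addr_gt0 // mulr_gt0.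
  have M1 : 0 < (2 * M + 1)^-1 * e by rewrite mulr_gt0 // invr_gt0.
  have [n _ nP] := @near_infty_natSinv_lt R (PosNum M1).
  exists n.+1 => //; rewrite -ler_pdivlMl //.
  exact/ltW/(nP n (leqnn n)).
have n_gt0 : 0 < n%:R :> R by rewrite ltr0n.
have eps0 : 0 < (n + n)%:R^-1 :> R by rewrite invr_gt0 ltr0n addn_gt0 n0.
(* with 2n jumps, a tolerance of 1/2n per jump *)
have [|s [us sn sJ sv]] := @long_delta_system R L (open_unit R) v _ eps0 _
    (@is_jump d L) (n + n)%N L_jumps.
  by move=> p; apply: finite_large_gaps => //; exact: CK_continuous.
(* y, the lowest of the upper jumps, lies above all the lower ones and above none
   of the upper ones *)
pose r := sort <=%O s.
have rs p : (p \in r) = (p \in s) by rewrite mem_sort.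
have szr : size r = (n + n)%N by rewrite size_sort.
pose lo := take n r; pose hi := drop n r.
have szlo : size lo = n by rewrite size_take szr -[X in (X < _)%N]addn0 ltn_add2l n0.
have szhi : size hi = n by rewrite size_drop szr addnK.
have rE : lo ++ hi = r by exact: cat_take_drop.
have : pairwise <%O (lo ++ hi).
  by rewrite rE -lt_sorted_pairwise lt_sorted_uniq_le sort_uniq us sort_le_sorted.
rewrite pairwise_cat => /and3P[/allrelP lohi _ hihi].
case E : hi szhi lohi hihi => [|y hi'] szhi lohi /=; first by rewrite -szhi in n0.
move=> /andP[/allP yhi _].
have [x xy] := pi_surj y.
pose g : CK R (S * X)%type := \sum_(p <- lo) q p - \sum_(p <- hi) q p.
have gE z : g z = \sum_(p <- lo) q p z - \sum_(p <- hi) q p z.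
  by rewrite -!CK_sumE.
have rJ p : p \in r -> is_jump p by rewrite rs => /sJ.
have loJ p : p \in lo -> is_jump p by move=> pl; apply: rJ; rewrite -rE mem_cat pl.
have hiJ p : p \in hi -> is_jump p.
  by move=> pl; apply: rJ; rewrite -rE mem_cat pl orbT.
exists (n%:R^-1 *: g); split.
- move=> t'; have -> : gap (U (n%:R^-1 *: g)) t' =
      n%:R^-1 * (\sum_(p <- lo) v p t' - \sum_(p <- hi) v p t').
    by rewrite linearZ gapZ linearB gapB !(linear_sum U) !gap_sum.
  rewrite normrM gtr0_norm ?invr_gt0 // mulrC; apply: le_trans ne.
  rewrite ler_pM2r ?invr_gt0 //.
  rewrite -[X in _ <= _ + X](_ : (n + n)%:R / (n + n)%:R = 1); last first.
    by rewrite divff // pnatr_eq0 -lt0n addn_gt0 n0.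
  apply: balanced_sum_bound => //.
  + by rewrite mulr_ge0 // ltW.
  + by rewrite E.
  + by rewrite rE sort_uniq.
  + by move=> p; rewrite rE => /rJ; exact: v_le.
  + by case: (sv t') => svt; [left|right] => p p'; rewrite rE !rs; exact: svt.
- exists x => s'; rewrite [LHS](_ : _ = n%:R^-1 * g (s', x)) // gE.
  rewrite (eq_big_seq (fun=> (after_cut t s')%:R)); last first.
    by move=> p pl; rewrite qE /=; [|exact: loJ]; rewrite xy lohi ?mem_head // mulr1.
  rewrite [X in _ - X]big1_seq; last first.
    move=> p /andP[_ ph]; rewrite qE /=; [|exact: hiJ]; rewrite xy ltNge.
    suff -> : (y <= p)%O by rewrite mulr0.
    by move: ph; rewrite E inE => /orP[/eqP->|/yhi/ltW].
  rewrite subr0 big_const_seq count_predT iter_addr_0 szlo -[X in _ * X]mulr_natl mulrA.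
  by rewrite mulVf ?mul1r // gt_eqF.
- move=> s' x' ns; rewrite [LHS](_ : _ = n%:R^-1 * g (s', x')) // gE.
  rewrite !big1_seq ?subrr ?mulr0 // => p /andP[_ pl].
    by rewrite qE /= ?(negbTE ns) ?mul0r //; exact: hiJ.
  by rewrite qE /= ?(negbTE ns) ?mul0r //; exact: loJ.
Qed.

(** The functions f t of [slice_with_small_gaps] are pairwise at distance at least 1, by
    the values at ((t,1), x), whereas two of their images are within 5e; e is chosen
    so that 5eM = 5/6. *)
Lemma not_bounded_below : ~ forall f, `|f| <= M * `|U f|.
Proof.
move=> U_below; pose e := (6 * M)^-1.
have e0 : 0 < e by rewrite invr_gt0 mulr_gt0.
have /choice[f fP] t := slice_with_small_gaps t e0.
have [||t [t' [_ _ tt' close]]] := @uncountable_small_gaps R (open_unit R) setT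
    (fun t => U (f t) : S -> R) e (@uncountable_open_unit R) e0.
- by move=> t _; exact: CK_continuous.
- by move=> t _; have [] := fP t.
have {}close : `|f t - f t'| <= 5 / 6.
  apply: le_trans (U_below _) _; rewrite linearB.
  have : `|U (f t) - U (f t')| <= 5 * e.
    by apply: CK_norm_le; [rewrite mulr_ge0 // ltW|exact: close].
  rewrite -(ler_pM2l M_gt0) => /le_trans; apply.
  by rewrite mulrCA /e invfM [M * _]mulrCA divff ?mulr1 ?gt_eqF.
wlog lt_tt' : t t' tt' close / val t < val t'.
  move=> wl; case: (ltgtP (val t) (val t')) => [|lt|/val_inj//]; first exact: wl.
  by apply: (wl t' t) => //; [exact/nesym|rewrite distrC].
have [_ [x fx] _] := fP t; have [_ _ f0] := fP t'.
have := le_trans (ler_CK_norm (f t - f t') (twin t true, x)) close.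
rewrite [X in `|X|](_ : _ = f t (twin t true, x) - f t' (twin t true, x)) //.
rewrite fx f0 after_cut_twin ?lexx -?ltNge // subr0 normr1.
by apply/negP; rewrite -ltNge ltr_pdivrMr // mul1r ltr_nat.
Qed.

End embedding.

Theorem corollary6p5 (R : realType) (I : Type) (d : I -> Order.disp_t)
    (K : forall i : I, compactLineType (d i))
    (I_nonempty : inhabited I)
    (K_separable : forall i : I, separable (K i))
    (K_nonmetrizable : forall i : I, ~ metrizable R (K i)) :
  ~ isomorphic (CK R (double_arrow R))
               (CK R (double_arrow R * prod_topology K)%type).
Proof.
move=> iso; have [i] := I_nonempty.
have [U [M [M0 U_le U_ge]]] := isomorphic_bounds iso.
(* if the product were empty, C(S x K) would be trivial *)
have [k0 _] : exists k0 : prod_topology K, True.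
  apply: contrapT => noK.
  have [T [V [TK _ _ _]]] := iso.
  have one_cts : continuous (fun _ : double_arrow R => 1 : R).
    exact: cst_continuous.
  pose one : CK R (double_arrow R) := (mkcts one_cts : continuousType _ _).
  have : one = 0.
    apply: (can_inj TK); apply: CK_ext => -[s k].
    by case: noK; exists k.
  move=> /(congr1 (fun h : CK R (double_arrow R) =>
    h (twin (half_unit R) true))) /eqP.
  by rewrite [X in _ == X -> _](_ : _ = 0) // oner_eq0.
apply: (@not_bounded_below R (prod_topology K) (d i) (K i)
  (fun k => k i) _ _ _ U M M0 U_le U_ge).
- exact: (@proj_continuous {classic I} (fun j => K j) i).
- by move=> y; exists (@dfwith {classic I} K k0 i y); exact: dfwithin.
- exact: uncountable_jumps.
Qed.
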